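(* Consider a sequence of natural numbers $ t ( n ) $, an integer sequence $ s ( n ) $, four integers $ b_1 \geq 2 $, $b_2 \geq 8$, $ c \geq 0 $ and $ m \geq 2 $ and four polynomials $ A_+ ( z ) $, $ A_- ( z ) $, $ B_+ ( z ) $ and $ B_- ( z ) $ in $ \mathbb{N} [ z ] $. In addition, let $ R $ be the radius of convergence of $ \mathrm{GF}_t ( z ) $ at zero, let $ h = \deg ( B_+ - B_- ) $, let $ E ( n, b ) $ be the expression \[ \left \lfloor \frac{\max\left( b^{n^2 + h n} A_+(b^{- n}) - b^{n^2 + h n} A_-(b^{- n}) ,\, 0 \right)}{\max\left( b^{h n} B_+(b^{- n}) - b^{h n} B_-(b^{- n}) ,\, 0\right)} \right \rfloor \bmod b^n \] and suppose that: \begin{enumerate} \item some term of $ t ( n ) $ is positive, \item the equality $ t ( r ) = s ( r ) + c^{r + 1} $ holds for every integer $ r \geq 0 $, \item the equality $ \mathrm{GF}_t ( z ) = ( A_+ ( z ) - A_- ( z ) ) / ( B_+ ( z ) - B_- ( z ) ) $ holds, \item the fraction $ ( A_+ ( z ) - A_- ( z ) ) / ( B_+ ( z ) - B_- ( z ) ) $ is irreducible, \item the inequality $ B_- ( 0 ) < B_+ ( 0 ) $ holds, \item the inequality $ b_1^{- m} < R $ holds, \item the inequality $ t ( r ) < b_1^{r - 2} $ holds for every integer $ r \geq m $. \end{enumerate} Then $ s ( r ) = E ( r , b_1 ) - c^{r + 1} $ for every integer $ r \geq m $. \newline If, instead of conditions 6 and 7, the sequence $ t ( n ) $ satisfies the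 conditions \begin{enumerate}[(a)] \item the inequality $b_2^{-1} < R$ holds and \item the inequality $t ( r ) < b_2^{r / 3}$ holds for every integer $r \geq 1$, \end{enumerate} then $ s ( r ) = E ( r , b_2 ) - c^{r + 1} $ for every integer $ r \geq 1 $.
   Context: $\mathbb{N}$ denotes the set of non-negative integers; sequences are indexed by $\mathbb{N}$. The generating function $\mathrm{GF}_t(z)$ of a sequence $t(n)$ is the formal power series $\sum_{i\ge 0} t(i) z^i$. The expression $\max(x-y,0)$ is the truncated subtraction of $y$ from $x$. Conventions: $0^0=1$ and $\lfloor x/0\rfloor = 0$, so $x \bmod 0 = x$ and $x \bmod 1 = 0$. *)

(* Defs.v *)
From mathcomp Require Import all_boot all_order all_algebra.
From mathcomp Require Import all_classical all_reals all_analysis.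
Set Implicit Arguments.
Unset Strict Implicit.
Unset Printing Implicit Defensive.
Import Order.TTheory GRing.Theory Num.Theory.
Import numFieldNormedType.Exports.
Local Open Scope classical_set_scope.
Local Open Scope ring_scope.

Definition polyQ (p : {poly nat}) : {poly rat} :=
  map_poly (fun n : nat => n%:R : rat) p.

(* Formal power series over rat are coefficient sequences nat -> rat. *)
Definition GF (t : nat -> nat) : nat -> rat := fun n => (t n)%:R.

Definition fps_of_poly (p : {poly rat}) : nat -> rat := fun n => p`_n.

Definition fps_mul (f g : nat -> rat) : nat -> rat :=
  fun n => \sum_(i < n.+1) f i * g (n - i)%N.

(* f = a / b in the ring of formal power series.  When the constant term of b
   is nonzero, b is a unit of that ring, so such an f exists and is unique. *)
Definition is_fps_quotient (f a b : nat -> rat) : Prop := fps_mul f b =1 a.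

Definition radius_of_convergence (R : realType) (a : nat -> R) : \bar R :=
  ereal_sup [set `|x|%:E | x in [set x : R | cvgn (pseries a x)]].

(* The degree h below is a natural number; size p = deg p + 1 for p != 0.
   The conventions floor(x / 0) = 0 and x mod 0 = x are those of the library
   (in rat, x / 0 = 0). *)
Definition E (Ap Am Bp Bm : {poly nat}) (n b : nat) : int :=
  let h := (size (polyQ Bp - polyQ Bm)).-1 in
  let x : rat := b%:R ^- n in
  let u : rat := b%:R ^+ (n ^ 2 + h * n) in
  let v : rat := b%:R ^+ (h * n) in
  let q : int := Num.floor
    (Num.max (u * (polyQ Ap).[x] - u * (polyQ Am).[x]) 0 /
     Num.max (v * (polyQ Bp).[x] - v * (polyQ Bm).[x]) 0) in
  (q %% (b ^ n)%N)%Z.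

(* Main.v *)
Require Import Defs.
From mathcomp Require Import all_boot all_order all_algebra.
From mathcomp Require Import all_classical all_reals all_analysis.
From mathcomp Require Import ring lra zify.
Set Implicit Arguments.
Unset Strict Implicit.
Unset Printing Implicit Defensive.
Import Order.TTheory GRing.Theory Num.Theory.
Import numFieldNormedType.Exports.
Local Open Scope ring_scope.

(**
Put d = b^n, so that 1/d lies inside the disc of convergence.  There
GF_t(y) B(y) = A(y), so a zero of B in [0, 1/d] would also be a zero of A;
coprimality excludes it, and B(0) > 0 gives B > 0 on [0, 1/d].  Hence both
truncated subtractions are harmless and the quotient equals
d^n GF_t(1/d) = sum_i t(i) d^(n-i).  Its terms with i < n are multiples of d and
the term i = n is t(n) < d.  The terms with i > n add up to less than 1, because
2^j t(n+j) < d^j for every j > 0; under the second set of conditions this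
follows by taking cubes, from t(r)^3 < b^r and 2^3 <= b.
*)

Definition fps_mul_poly (R : nzRingType) (f : nat -> R) (p : {poly R})
    (k : nat) : R :=
  \sum_(i < k.+1) f i * p`_(k - i).

Lemma fps_mul_polyMXaddC (R : comNzRingType) (f : nat -> R) (p : {poly R})
    (c : R) (k : nat) :
  fps_mul_poly f (p * 'X + c%:P) k =
    (if k is k'.+1 then fps_mul_poly f p k' else 0) + c * f k.
Proof.
rewrite /fps_mul_poly big_ord_recr /= subnn coefD coefMX coefC add0r.
rewrite [_ * c]mulrC; congr (_ + _); case: k => [|k]; first by rewrite big_ord0.
apply: eq_bigr => i _.
by rewrite subSn ?leq_ord// coefD coefMX coefC addr0.
Qed.

Lemma fps_mul_poly_ratr (R : numFieldType) (t : nat -> nat) (A B : {poly rat}) :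
  is_fps_quotient (GF t) (fps_of_poly A) (fps_of_poly B) ->
  fps_mul_poly (fun n => (t n)%:R : R) (map_poly ratr B)
    =1 nth 0 (map_poly ratr A).
Proof.
move=> tBA k; rewrite coef_map /= -[A`_k]/(fps_of_poly A k) -tBA.
rewrite /fps_mul rmorph_sum.
by apply: eq_bigr => i _; rewrite coef_map /= rmorphM /= ratr_nat.
Qed.

Section PowerSeriesTimesPolynomial.

Variables (R : realType) (f : nat -> R).
Implicit Types (p : {poly R}) (x l : R).

Lemma pseries_mul_poly0 x : pseries (fps_mul_poly f 0) x = (fun=> 0).
Proof.
apply/funext => n; rewrite /pseries /series /=; apply: big1 => k _.
by rewrite /fps_mul_poly big1 ?mul0r// => i _; rewrite coef0 mulr0.
Qed.

Lemma pseries_mul_polyMXaddC p c x n :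
  pseries (fps_mul_poly f (p * 'X + c%:P)) x n.+1 =
  x * pseries (fps_mul_poly f p) x n + c * pseries f x n.+1.
Proof.
rewrite /pseries /series /= !big_mkord.
under eq_bigr do rewrite fps_mul_polyMXaddC mulrDl -mulrA.
rewrite big_split /=; congr (_ + _); last by rewrite mulr_sumr.
rewrite big_ord_recl mul0r add0r mulr_sumr.
by apply: eq_bigr => i _; rewrite /= exprS mulrCA.
Qed.

Lemma cvg_pseries_mul_poly p x l :
  (pseries f x @ \oo --> l)%classic ->
  (pseries (fps_mul_poly f p) x @ \oo --> l * p.[x])%classic.
Proof.
move=> fl; elim/poly_ind: p => [|p c IH].
  by rewrite pseries_mul_poly0 horner0 mulr0; exact: cvg_cst.
have -> : l * (p * 'X + c%:P).[x] = x * (l * p.[x]) + c * l.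
  by rewrite hornerMXaddC; ring.
rewrite -cvg_shiftS; under eq_fun do rewrite pseries_mul_polyMXaddC.
by apply: cvgD; apply: cvgMr => //; rewrite cvg_shiftS.
Qed.

End PowerSeriesTimesPolynomial.

Lemma cvg_pseries_poly (R : realType) (p : {poly R}) (x : R) :
  (pseries (nth 0 p) x @ \oo --> p.[x])%classic.
Proof.
apply: cvg_near_cst; exists (size p) => // n /= pn.
by rewrite /pseries /series /= big_mkord -horner_coef_wide.
Qed.

Lemma is_cvg_pseries_lt_radius (R : realType) (f : nat -> R) (x : R) :
  (`|x|%:E < radius_of_convergence f)%E -> cvgn (pseries f x).
Proof.
move=> /ereal_sup_gt[_ [z /= fz <-]]; rewrite lte_fin.
exact: is_cvg_pseries_inside.
Qed.

Lemma limn_pseries_ge0 (R : realType) (f : nat -> R) (x : R) :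
  (forall i, 0 <= f i) -> 0 <= x -> cvgn (pseries f x) ->
  0 <= limn (pseries f x).
Proof.
move=> f0 x0 cvgf; apply: limr_ge => //; apply: nearW => k.
by rewrite /pseries /series /= sumr_ge0// => i _; rewrite mulr_ge0// exprn_ge0.
Qed.

Section RationalPowerSeries.

Variables (R : realType) (f : nat -> R) (A B : {poly R}).
Hypothesis fBA : fps_mul_poly f B =1 nth 0 A.

Lemma limn_pseries_rational x :
  cvgn (pseries f x) -> limn (pseries f x) * B.[x] = A.[x].
Proof.
move=> /(@cvg_pseries_mul_poly _ _ B); rewrite (funext fBA) => fBx.
exact: cvg_unique fBx (@cvg_pseries_poly _ A x).
Qed.

Lemma rational_denominator_gt0 x :
  coprimep A B -> 0 < B.[0] -> 0 <= x ->
  (x%:E < radius_of_convergence f)%E -> 0 < B.[x].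
Proof.
move=> AB B0 x0 xf; rewrite ltNge; apply/negP => Bx.
have [|y /andP[y0 yx]] := @poly_ivt R (- B) 0 x x0.
  by rewrite !hornerN oppr_le0 oppr_ge0 (ltW B0).
rewrite rootN => By.
have cvgy : cvgn (pseries f y).
  apply: is_cvg_pseries_lt_radius; apply: le_lt_trans xf.
  by rewrite lee_fin ger0_norm.
move: AB; rewrite coprimep_sym => /coprimep_root-/(_ _ By).
by rewrite -(limn_pseries_rational cvgy) (rootP By) mulr0 eqxx.
Qed.

End RationalPowerSeries.

Lemma sum_lt_halves_ub (R : realFieldType) (u : nat -> R) :
  (forall i, 0 <= u i < 2 ^- i.+1) ->
  exists2 q, q < 1 & forall k, \sum_(i < k) u i <= q.
Proof.
move=> u_itv; have u_ge0 i : 0 <= u i by have /andP[] := u_itv i.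
have u_lt i : u i < 2 ^- i.+1 by have /andP[] := u_itv i.
exists (u 0%N + 2^-1); first by have := u_lt 0%N; rewrite expr1; lra.
case=> [|k]; first by rewrite big_ord0 addr_ge0// invr_ge0.
suff : \sum_(i < k.+1) u i <= u 0%N + 2^-1 - 2 ^- k.+1.
  by move=> /le_trans; apply; rewrite gerBl invr_ge0 exprn_ge0.
elim: k => [|k IH]; first by rewrite big_ord1 expr1 addrK.
rewrite big_ord_recr /=; apply: le_trans (lerD IH (ltW (u_lt _))) _.
rewrite -!exprVn [_ ^+ k.+2]exprS; lra.
Qed.

Section Digits.

Variable t : nat -> nat.

Definition isolated_digit (d n : nat) : Prop :=
  (t n < d)%N /\ forall j, (0 < j)%N -> (2 ^ j * t (n + j) < d ^ j)%N.

Definition base_value (d n : nat) : nat := \sum_(i < n.+1) t i * d ^ (n - i).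

Lemma base_value_mod d n : (t n < d)%N -> (base_value d n %% d)%N = t n.
Proof.
move=> td; rewrite /base_value big_ord_recr /= subnn muln1.
have -> : (\sum_(i < n) t i * d ^ (n - i) =
    (\sum_(i < n) t i * d ^ (n - i).-1) * d)%N.
  rewrite big_distrl; apply: eq_bigr => i _ /=.
  by rewrite -mulnA -expnSr prednK// subn_gt0.
by rewrite modnMDl modn_small.
Qed.

Variable R : realType.
Let tR : nat -> R := fun n => (t n)%:R.

Lemma scaled_pseries_base_value (d n k : nat) : (0 < d)%N ->
  d%:R ^+ n * pseries tR d%:R^-1 (n.+1 + k)%N =
  (base_value d n)%:R + \sum_(i < k) tR (n + i.+1)%N * d%:R ^- i.+1.
Proof.
move=> d0; have dX_neq0 j : d%:R ^+ j != 0 :> R.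
  by rewrite expf_neq0// pnatr_eq0 -lt0n.
rewrite /pseries /series /= big_mkord big_split_ord /= mulrDr !mulr_sumr.
rewrite natr_sum; congr (_ + _).
  all: apply: eq_bigr => i _ /=; rewrite mulrCA exprVn.
  by rewrite natrM natrX expfB_cond// pnatr_eq0 gtn_eqF//= leq_ord.
by rewrite addSnnS exprD invfM mulVKf.
Qed.

Lemma floor_scaled_pseries (d n : nat) : isolated_digit d n ->
  cvgn (pseries tR d%:R^-1) ->
  Num.floor (d%:R ^+ n * limn (pseries tR d%:R^-1)) = base_value d n :> int.
Proof.
move=> [td tj] cvgt; have d0 : (0 < d)%N by apply: leq_ltn_trans td.
have dX_gt0 j : 0 < d%:R ^+ j :> R by rewrite exprn_gt0// ltr0n.
have tail_ge0 i : 0 <= tR (n + i.+1)%N * d%:R ^- i.+1.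
  by rewrite divr_ge0 ?ler0n// ltW.
have [i|q q1 tailq] :=
    @sum_lt_halves_ub R (fun i => tR (n + i.+1)%N * d%:R ^- i.+1).
  rewrite tail_ge0 ltr_pdivrMr// ltr_pdivlMl ?exprn_gt0//.
  by rewrite -!natrX -natrM ltr_nat tj.
apply: floor_def; rewrite intrD; apply/andP; split.
  rewrite -ler_pdivrMl//; apply: limr_ge => //.
  exists n.+1 => // k /= nk; rewrite ler_pdivrMl// -(subnKC nk).
  by rewrite scaled_pseries_base_value// lerDl sumr_ge0.
apply: (@le_lt_trans _ _ ((base_value d n)%:R + q)); last by rewrite ltrD2l.
rewrite -ler_pdivlMl//; apply: limr_le => //.
exists n.+1 => // k /= nk; rewrite ler_pdivlMl// -(subnKC nk).
by rewrite scaled_pseries_base_value// lerD2l.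
Qed.

End Digits.

Lemma isolated_digit_lt_expn (t : nat -> nat) (b n : nat) :
  (2 <= b)%N -> (2 <= n)%N ->
  (forall r, (n <= r)%N -> (t r < b ^ (r - 2))%N) ->
  isolated_digit t (b ^ n) n.
Proof.
move=> b2 n2 tb; split=> [|j j0].
  by apply: leq_trans (tb _ (leqnn n)) _; rewrite leq_exp2l// leq_subr.
apply: (@leq_trans (b ^ j * b ^ (n + j - 2))).
  apply: (@leq_ltn_trans (b ^ j * t (n + j)%N)).
    by rewrite leq_mul2r leq_exp2r// b2 orbT.
  by rewrite ltn_pmul2l ?expn_gt0 ?(ltnW b2)// tb// leq_addr.
rewrite -expnD -expnM leq_exp2l//; nia.
Qed.

Lemma isolated_digit_expn_lt_expn (t : nat -> nat) (b n k : nat) :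
  (3 <= k)%N -> (2 ^ k <= b)%N -> (1 <= n)%N ->
  (forall r, (n <= r)%N -> (t r ^ k < b ^ r)%N) ->
  isolated_digit t (b ^ n) n.
Proof.
move=> k3 kb n1 tb; have k0 : (0 < k)%N by apply: leq_trans k3.
have b1 : (1 < b)%N by apply: leq_trans kb; rewrite -(expn0 2) ltn_exp2l.
split=> [|j j0].
  apply: leq_ltn_trans (tb _ (leqnn n)).
  by case: (t n) => // a; rewrite -{1}(expn1 a.+1) leq_pexp2l.
rewrite -(ltn_exp2r _ _ k0) expnMn expnAC.
apply: (@leq_trans (b ^ j * b ^ (n + j))).
  apply: (@leq_ltn_trans (b ^ j * t (n + j)%N ^ k)).
    by rewrite leq_mul2r leq_exp2r// kb orbT.
  by rewrite ltn_pmul2l ?expn_gt0 ?(ltnW b1)// tb// leq_addr.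
rewrite -expnD -!expnM leq_exp2l//.
apply: (@leq_trans (n * j * 3)); first by nia.
by rewrite -mulnA !leq_mul2l k3 !orbT.
Qed.

Lemma ltr_powR_div_nat (R : realType) (a b r k : nat) : (0 < k)%N ->
  (a%:R < (b%:R : R) `^ (r%:R / k%:R)) = (a ^ k < b ^ r)%N.
Proof.
move=> k0; rewrite -(ltr_nat R) !natrX.
rewrite -[LHS](@ltr_pXn2r _ k) ?nnegrE ?powR_ge0//.
rewrite -(powR_mulrn k (powR_ge0 _ _)) -powRrM divfK ?pnatr_eq0 -?lt0n//.
by rewrite powR_mulrn.
Qed.

Section DigitFormula.

Variables (Ap Am Bp Bm : {poly nat}).
Let A : {poly rat} := polyQ Ap - polyQ Am.
Let B : {poly rat} := polyQ Bp - polyQ Bm.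

Lemma E_floor n b : (0 < b)%N -> 0 <= A.[b%:R ^- n] -> 0 < B.[b%:R ^- n] ->
  E Ap Am Bp Bm n b =
  (Num.floor ((b ^ n)%:R ^+ n * (A.[b%:R ^- n] / B.[b%:R ^- n]))
     %% (b ^ n)%N)%Z.
Proof.
move=> b0 A0 B0; rewrite /E -/B.
have bX k : 0 < b%:R ^+ k :> rat by rewrite exprn_gt0// ltr0n.
rewrite -!mulrBr -!hornerN -!hornerD -/A -/B.
rewrite !max_l ?(mulr_ge0 (ltW (bX _))) ?(ltW B0)// natrX -exprM mulnn.
by rewrite exprD -[_ * _ * A.[_]]mulrA -mulrA -mulf_div divff ?mul1r// gt_eqF.
Qed.

Variables (R : realType) (t : nat -> nat).
Let tR : nat -> R := fun n => (t n)%:R.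

Lemma E_isolated_digit n b :
  is_fps_quotient (GF t) (fps_of_poly A) (fps_of_poly B) ->
  coprimep A B -> (Bm.[0%R] < Bp.[0%R])%N -> (0 < b)%N ->
  ((b%:R ^- n)%:E < radius_of_convergence tR)%E ->
  isolated_digit t (b ^ n) n ->
  E Ap Am Bp Bm n b = (t n)%:Z.
Proof.
move=> tBA AB B0 b0 bn_lt tn.
pose x : rat := b%:R ^- n; pose X : R := b%:R ^- n.
have XE : X = ratr x by rewrite /x fmorphV rmorphXn /= ratr_nat.
have hornerX p : (map_poly ratr p).[X] = ratr p.[x] by rewrite XE horner_map.
have X0 : 0 <= X by rewrite invr_ge0 exprn_ge0.
have cvgX : cvgn (pseries tR X).
  by apply: is_cvg_pseries_lt_radius; rewrite ger0_norm.
have tBAR := fps_mul_poly_ratr R tBA.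
have BX : 0 < ratr B.[x] :> R.
  rewrite -hornerX.
  apply: (rational_denominator_gt0 tBAR) => //.
    by rewrite coprimep_map.
  rewrite horner_coef0 coef_map /= ltr0q coefB !coef_map_id0//.
  by rewrite subr_gt0 ltr_nat -!horner_coef0.
have LX : limn (pseries tR X) * ratr B.[x] = ratr A.[x].
  by rewrite -!hornerX (limn_pseries_rational tBAR).
have Ax : 0 <= A.[x].
  by rewrite -(ler0q R) -LX mulr_ge0 ?limn_pseries_ge0// ltW.
rewrite E_floor//; last by rewrite -(ltr0q R).
have XV : X = (b ^ n)%:R^-1 by rewrite natrX.
rewrite -(floor_rat R) rmorphM rmorphXn /= ratr_nat fmorph_div /= -LX.
rewrite mulfK ?gt_eqF// XV floor_scaled_pseries -?XV//.
by rewrite modz_nat base_value_mod//; case: tn.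
Qed.

End DigitFormula.

Theorem theorem5p4 (R : realType) (t : nat -> nat) (s : nat -> int)
    (b1 b2 c m : nat) (Ap Am Bp Bm : {poly nat})
    (hb1 : (2 <= b1)%N) (hb2 : (8 <= b2)%N) (hm : (2 <= m)%N)
    (h1 : exists n : nat, (0 < t n)%N)
    (h2 : forall r : nat, (t r)%:Z = s r + (c ^ r.+1)%N%:Z)
    (h3 : is_fps_quotient (GF t) (fps_of_poly (polyQ Ap - polyQ Am))
            (fps_of_poly (polyQ Bp - polyQ Bm)))
    (h4 : coprimep (polyQ Ap - polyQ Am) (polyQ Bp - polyQ Bm))
    (h5 : (Bm.[0%R] < Bp.[0%R])%N) :
  (((b1%:R ^- m)%:E < radius_of_convergence (fun n => (t n)%:R : R))%E ->
   (forall r : nat, (m <= r)%N -> (t r < b1 ^ (r - 2))%N) ->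
   forall r : nat, (m <= r)%N ->
     s r = E Ap Am Bp Bm r b1 - (c ^ r.+1)%N%:Z)
  /\
  (((b2%:R^-1)%:E < radius_of_convergence (fun n => (t n)%:R : R))%E ->
   (forall r : nat, (1 <= r)%N ->
      ((t r)%:R : R) < (b2%:R : R) `^ (r%:R / 3%:R)) ->
   forall r : nat, (1 <= r)%N ->
     s r = E Ap Am Bp Bm r b2 - (c ^ r.+1)%N%:Z).
Proof.
have sE b k r : (0 < b)%N -> (k <= r)%N ->
    ((b%:R ^- k)%:E < radius_of_convergence (fun n => (t n)%:R : R))%E ->
    isolated_digit t (b ^ r) r -> s r = E Ap Am Bp Bm r b - (c ^ r.+1)%N%:Z.
  move=> b_gt0 kr kt tr.
  rewrite (E_isolated_digit (R := R) h3 h4 h5 b_gt0 _ tr) ?h2 ?addrK//.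
  apply: le_lt_trans kt.
  by rewrite lee_fin lef_pV2 ?posrE ?exprn_gt0 ?ltr0n// ler_weXn2l// ler1n.
split=> [Rb tb r mr|Rb tb r r1].
- apply: (sE b1 m) => //; first exact: leq_trans hb1.
  apply: isolated_digit_lt_expn => [//||k rk]; first exact: leq_trans mr.
  by apply: tb; apply: leq_trans rk.
- apply: (sE b2 1%N) => //; first exact: leq_trans hb2.
  apply: (@isolated_digit_expn_lt_expn _ _ _ 3) => // k rk.
  by rewrite -(ltr_powR_div_nat R)// tb// (leq_trans r1).
Qed.
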